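(* Let $\mathcal{A}$ and $\mathcal{B}$ be $C^{*}$-algebras, let $\Xi$ be a Hilbert $\mathcal{A}$-module and $\nabla$ a Hilbert $\mathcal{B}$-module. Let $f:\Xi \rightarrow \nabla$ be a mapping for which there exists a function $\varphi:\Xi^{3}\rightarrow[0,\infty)$ such that $$\| f(\mu x+y)-\mu f(x)-f(y)\| \leq \varphi(x,y,0)$$ and $$\| f(\langle x,y\rangle z)-\langle f(x),f(y)\rangle f(z)\| \leq \varphi(x,y,z)$$ for all $x,y,z\in\Xi$ and all $\mu\in\mathbb{T}$. If there exists $0\leq L<1$ such that $\varphi(x,y,z)\leq 2L\,\varphi\left(\frac{x}{2},\frac{y}{2},\frac{z}{2}\right)$ for all $x,y,z\in\Xi$, then there exists a unique Hilbert $C^{*}$-module homomorphism $H:\Xi\rightarrow\nabla$ such that $$\|f(x)-H(x)\|\leq \frac{1}{2-2L}\varphi(x,x,0)$$ for all $x\in\Xi$.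
   Context: $\mathbb{T}=\{z\in\mathbb{C}:|z|=1\}$. For a $C^{*}$-algebra $\mathcal{A}$, a (left) Hilbert $\mathcal{A}$-module is a complex linear space $\Xi$ with a compatible left $\mathcal{A}$-module action ($\lambda(ax)=(\lambda a)x=a(\lambda x)$) and a map $\langle\cdot,\cdot\rangle:\Xi\times\Xi\to\mathcal{A}$ that is linear in the first variable, satisfies $\langle ax,y\rangle=a\langle x,y\rangle$, $\langle x,y\rangle^{*}=\langle y,x\rangle$, $\langle x,x\rangle\geq 0$ with equality iff $x=0$, and such that $\Xi$ is complete in the norm $\|x\|=\|\langle x,x\rangle\|^{1/2}$. For a Hilbert $\mathcal{A}$-module $\Xi$ and a Hilbert $\mathcal{B}$-module $\nabla$, a Hilbert $C^{*}$-module homomorphism is a $\mathbb{C}$-linear map $H:\Xi\to\nabla$ with $H(\langle x,y\rangle z)=\langle H(x),H(y)\rangle H(z)$ for all $x,y,z\in\Xi$. *)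

(* Defs.v *)
From HB Require Import structures.
From mathcomp Require Import all_boot all_order all_algebra.
From mathcomp Require Import complex.
From mathcomp Require Import reals.
Set Implicit Arguments. Unset Strict Implicit. Unset Printing Implicit Defensive.
Import Order.TTheory GRing.Theory Num.Theory.
Local Open Scope ring_scope.

Definition cabs (R : realType) (z : R[i]) : R :=
  let: Complex a b := z in Num.sqrt (a ^+ 2 + b ^+ 2).

Definition complete_wrt (R : realType) (V : zmodType) (nrm : V -> R) : Prop :=
  forall u : nat -> V,
    (forall e : R, 0 < e -> exists N : nat, forall m n : nat,
        (N <= m)%N -> (N <= n)%N -> nrm (u m - u n) < e) ->
    exists l : V, forall e : R, 0 < e -> exists N : nat, forall n : nat,
        (N <= n)%N -> nrm (u n - l) < e.

Definition cstar_axioms (R : realType) (A : lmodType R[i])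
    (mul : A -> A -> A) (star : A -> A) (nrm : A -> R) : Prop :=
  (
      (forall a b c, mul a (mul b c) = mul (mul a b) c) /\
      (forall a b c, mul (a + b) c = mul a c + mul b c) /\
      (forall a b c, mul a (b + c) = mul a b + mul a c) /\
      (forall (l : R[i]) a b, mul (l *: a) b = l *: mul a b
                           /\ mul a (l *: b) = l *: mul a b) /\
      (forall a b, star (a + b) = star a + star b) /\
      (forall (l : R[i]) a, star (l *: a) = conjc l *: star a) /\
      (forall a, star (star a) = a) /\
      (forall a b, star (mul a b) = mul (star b) (star a)) /\
      (
        (forall a, 0 <= nrm a) /\
        (forall a, nrm a = 0 -> a = 0) /\
        (forall a b, nrm (a + b) <= nrm a + nrm b) /\
        (forall (l : R[i]) a, nrm (l *: a) = cabs l * nrm a) /\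
        (forall a b, nrm (mul a b) <= nrm a * nrm b) /\
        (forall a, nrm (mul (star a) a) = nrm a ^+ 2) /\
        complete_wrt nrm )).

Record cstar_alg (R : realType) := CStarAlg {
  ca_car :> lmodType R[i];
  ca_mul : ca_car -> ca_car -> ca_car;
  ca_star : ca_car -> ca_car;
  ca_norm : ca_car -> R;
  ca_ax : cstar_axioms ca_mul ca_star ca_norm }.

Definition ca_positive (R : realType) (A : cstar_alg R) (a : A) : Prop :=
  exists b : A, a = ca_mul (ca_star b) b.

Definition hmod_axioms (R : realType) (A : cstar_alg R) (X : lmodType R[i])
    (act : A -> X -> X) (ip : X -> X -> A) : Prop :=
  (
      (forall a b x, act (a + b) x = act a x + act b x) /\
      (forall a x y, act a (x + y) = act a x + act a y) /\
      (forall a b x, act (ca_mul a b) x = act a (act b x)) /\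
      (forall (l : R[i]) a x, l *: act a x = act (l *: a) x
                           /\ l *: act a x = act a (l *: x)) /\
      (forall x y z, ip (x + y) z = ip x z + ip y z) /\
      (forall (l : R[i]) x y, ip (l *: x) y = l *: ip x y) /\
      (forall a x y, ip (act a x) y = ca_mul a (ip x y)) /\
      (forall x y, ca_star (ip x y) = ip y x) /\
      ((forall x, ca_positive (ip x x)) /\
          (forall x, ip x x = 0 <-> x = 0) /\
          complete_wrt (fun x => Num.sqrt (ca_norm (ip x x))))).

Record hmod (R : realType) (A : cstar_alg R) := HMod {
  hm_car :> lmodType R[i];
  hm_act : A -> hm_car -> hm_car;
  hm_ip : hm_car -> hm_car -> A;
  hm_ax : hmod_axioms hm_act hm_ip }.

Definition hm_norm (R : realType) (A : cstar_alg R) (X : hmod A) (x : X) : R :=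
  Num.sqrt (ca_norm (hm_ip x x)).

Definition hilbert_hom (R : realType) (A B : cstar_alg R) (X : hmod A)
    (Y : hmod B) (H : X -> Y) : Prop :=
  ((forall x y, H (x + y) = H x + H y) /\
      (forall (l : R[i]) x, H (l *: x) = l *: H x) /\
      (forall x y z, H (hm_act (hm_ip x y) z)
                     = hm_act (hm_ip (H x) (H y)) (H z))).

(* Main.v *)
Require Import Defs.
From HB Require Import structures.
From mathcomp Require Import all_boot all_order all_algebra.
From mathcomp Require Import complex.
From mathcomp Require Import boolp classical_sets reals.
From mathcomp Require Import topology normedtype sequences.
From mathcomp Require Import ring lra.
Import Order.TTheory GRing.Theory Num.Theory numFieldNormedType.Exports.
Local Open Scope ring_scope.
Local Open Scope complex_scope.
Local Open Scope classical_set_scope.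

(** The map is [H x = lim 2^-n f (2^n x)] (Hyers' method): the control on [phi]
    makes the sequence geometrically Cauchy and kills all defects in the limit,
    and additivity together with homogeneity for unimodular scalars gives
    complex linearity.

    The module norm is only given as [sqrt |<x, x>|], and a positive element of
    a C*-algebra only as some [b^* b]. The triangle inequality and the continuity
    of the triple product [<x, y> z] follow from Cauchy-Schwarz, which is reduced
    to [|b^* b| <= |b^* b + d^* d|]. The latter is proved in unital C*-algebras
    and applied to the bounded adjointable operators on the algebra, among which
    there is an identity even if the algebra has no unit. The cone of self-adjoint
    [x] with [|t - x| <= t] for some [t] is visibly closed under sums, its
    elements have square roots in their bicommutants, and Kaplansky's argument
    shows that it contains all [x^* x]. *)

Set Implicit Arguments. Unset Strict Implicit. Unset Printing Implicit Defensive.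

(** * Norms and convergence *)

Section ComplexScalars.
Variable R : realType.
Implicit Types (z : R[i]) (t : R).

Lemma cabs_real t : cabs t%:C = `|t|.
Proof. by rewrite /cabs /= expr0n addr0 sqrtr_sqr. Qed.

Lemma cabs1 : cabs (1 : R[i]) = 1.
Proof. by rewrite (cabs_real 1) normr1. Qed.

Lemma cabs_i : cabs ('i%C : R[i]) = 1.
Proof. by rewrite /= expr0n add0r expr1n sqrtr1. Qed.

Lemma conjc_i : conjc 'i%C = - 'i%C :> R[i].
Proof. by apply/eqP; rewrite eq_complex /= oppr0 !eqxx. Qed.

Lemma cabs_conj z : cabs (conjc z) = cabs z.
Proof. by case: z => a b; rewrite /= sqrrN. Qed.

Lemma cabs_ge0 z : 0 <= cabs z.
Proof. by case: z => a b; rewrite sqrtr_ge0. Qed.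

End ComplexScalars.

Section Norms.
Variables (R : realType) (V : lmodType R[i]).

Definition is_norm (N : V -> R) : Prop :=
  [/\ forall x, N x = 0 -> x = 0,
      forall x y, N (x + y) <= N x + N y &
      forall l x, N (l *: x) = cabs l * N x].

Variables (N : V -> R) (N_norm : is_norm N).
Implicit Types (x y z : V) (t : R).

Lemma norm0_eq0 x : N x = 0 -> x = 0.
Proof. by case: N_norm => + _ _; apply. Qed.

Lemma norm_triangle x y : N (x + y) <= N x + N y.
Proof. by case: N_norm. Qed.

Lemma norm_scale l x : N (l *: x) = cabs l * N x.
Proof. by case: N_norm. Qed.

Lemma norm_real_scale t x : N (t%:C *: x) = `|t| * N x.
Proof. by rewrite norm_scale cabs_real. Qed.

Lemma norm_zero : N 0 = 0.
Proof. by rewrite -(scale0r 0) (norm_real_scale 0) normr0 mul0r. Qed.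

Lemma norm_opp x : N (- x) = N x.
Proof.
by rewrite -scaleN1r -(rmorphN1 (real_complex R)) norm_real_scale normrN1 mul1r.
Qed.

Lemma norm_ge0 x : 0 <= N x.
Proof.
by have := norm_triangle x (- x); rewrite subrr norm_zero norm_opp; lra.
Qed.

Lemma norm_le0_eq0 x : N x <= 0 -> x = 0.
Proof. by move=> x0; apply/norm0_eq0/le_anti; rewrite x0 norm_ge0. Qed.

Lemma norm_distC x y : N (x - y) = N (y - x).
Proof. by rewrite -norm_opp opprB. Qed.

Lemma norm_dist_triangle z x y : N (x - y) <= N (x - z) + N (z - y).
Proof. by apply: le_trans (norm_triangle _ _); rewrite addrA subrK. Qed.

End Norms.

Section NormConvergence.
Variables (R : realType) (V : lmodType R[i]) (N : V -> R).
Hypothesis N_norm : is_norm N.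
Implicit Types (u v : nat -> V) (a b l : V) (r : nat -> R).

Definition cvg_wrt u l : Prop := (fun n => N (u n - l)) @ \oo --> (0 : R).

Lemma cvg_wrtP u l : cvg_wrt u l <->
  forall e, 0 < e -> exists K, forall n, (K <= n)%N -> N (u n - l) < e.
Proof.
have abs0 n : `|0 - N (u n - l)| = N (u n - l).
  by rewrite sub0r normrN ger0_norm // norm_ge0.
split=> [/cvgrPdist_lt ul e /ul [K _ Ke]|ul].
  by exists K => n /Ke /=; rewrite abs0.
apply/cvgrPdist_lt => e /ul [K Ke]; exists K => // n /Ke /=.
by rewrite abs0.
Qed.

Lemma cvg_wrt_squeeze u l r :
  r @ \oo --> (0 : R) -> (forall n, N (u n - l) <= r n) -> cvg_wrt u l.
Proof.
move=> r0 ur; apply: squeeze_cvgr (cvg_cst (0 : R)) r0.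
by apply: nearW => n; rewrite ur norm_ge0.
Qed.

Lemma cvg_wrt_cst a : cvg_wrt (fun=> a) a.
Proof.
by apply: cvg_wrt_squeeze (cvg_cst 0) _ => n; rewrite subrr norm_zero.
Qed.

Lemma cvg_wrt_subseq u l (k : nat -> nat) :
  (forall n, n <= k n)%N -> cvg_wrt u l -> cvg_wrt (u \o k) l.
Proof.
move=> kn /cvg_wrtP ul; apply/cvg_wrtP => e /ul [K Ke].
by exists K => n Kn; apply: Ke; apply: leq_trans (kn n).
Qed.

Lemma cvg_wrtD u v a b :
  cvg_wrt u a -> cvg_wrt v b -> cvg_wrt (fun n => u n + v n) (a + b).
Proof.
move=> ua vb.
apply: (cvg_wrt_squeeze (r := fun n => N (u n - a) + N (v n - b))).
  by rewrite -[0 in X in _ --> X]addr0; apply: cvgD.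
by move=> n; rewrite opprD addrACA norm_triangle.
Qed.

Lemma cvg_wrtZ c u a : cvg_wrt u a -> cvg_wrt (fun n => c *: u n) (c *: a).
Proof.
move=> ua; apply: (cvg_wrt_squeeze (r := fun n => cabs c * N (u n - a))).
  by rewrite -(mulr0 (cabs c)); apply: cvgM (cvg_cst _) ua.
by move=> n; rewrite -scalerBr norm_scale.
Qed.

Lemma cvg_wrt_dist0 u v a :
  cvg_wrt u a -> (fun n => N (v n - u n)) @ \oo --> (0 : R) -> cvg_wrt v a.
Proof.
move=> ua uv.
apply: (cvg_wrt_squeeze (r := fun n => N (v n - u n) + N (u n - a))).
  by rewrite -[0 in X in _ --> X]addr0; apply: cvgD.
by move=> n; apply: norm_dist_triangle.
Qed.

Lemma cvg_wrt_norm u a : cvg_wrt u a -> (fun n => N (u n)) @ \oo --> N a.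
Proof.
move=> /cvg_wrtP ua; apply/cvgrPdist_lt => e /ua [K Ke].
exists K => // n /Ke /=; apply: le_lt_trans; rewrite ler_norml.
have := norm_triangle N_norm (u n - a) a.
have := norm_triangle N_norm (a - u n) (u n).
by rewrite !subrK (norm_distC N_norm a); lra.
Qed.

Lemma cvg_wrt_normB u a x :
  cvg_wrt u a -> (fun n => N (u n - x)) @ \oo --> N (a - x).
Proof. by move=> ua; apply/cvg_wrt_norm/cvg_wrtD/cvg_wrt_cst. Qed.

Lemma cvg_wrt_le u a x (c : R) : cvg_wrt u a ->
  (\forall n \near \oo, N (u n - x) <= c) -> N (a - x) <= c.
Proof. by move=> ua; apply: (cvgr_to_le (cvg_wrt_normB ua)). Qed.

Lemma cvg_wrt_unique u a a' : cvg_wrt u a -> cvg_wrt u a' -> a = a'.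
Proof.
move=> /cvg_wrt_normB ua ua'; apply/subr0_eq/(norm0_eq0 N_norm).
exact: cvg_unique (ua a') ua'.
Qed.

Lemma dominated_increments_cvg_wrt u r (s : R) : complete_wrt N ->
  (forall n, N (u n.+1 - u n) <= r n.+1 - r n) -> r @ \oo --> s ->
  exists2 l, cvg_wrt u l & forall n, N (u n - l) <= s - r n.
Proof.
move=> Nc ur rs.
have dist n m : (n <= m)%N -> N (u m - u n) <= r m - r n.
  move=> /subnKC <-; elim: (m - n)%N => [|d IH].
    by rewrite addn0 !subrr norm_zero.
  apply: le_trans (norm_dist_triangle N_norm (u (n + d)%N) _ _) _.
  by have := ur (n + d)%N; rewrite addnS; move: IH; lra.
have r_le n : r n <= s.
  apply: (cvgr_to_ge rs); exists n => // m /= nm.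
  by rewrite -subr_ge0 (le_trans (norm_ge0 N_norm _) (dist n m nm)).
have [e e0|l /cvg_wrtP ul] := Nc u.
  have [|K _ Ke] := (cvgrPdist_lt _ _).1 rs (e / 2); first by lra.
  have := Ke K (leqnn K); rewrite /= ger0_norm ?subr_ge0 // => sK.
  exists K => m n Km Kn.
  apply: le_lt_trans (norm_dist_triangle N_norm (u K) _ _) _.
  have := dist _ _ Km; have := dist _ _ Kn; rewrite (norm_distC N_norm (u K)).
  by have := r_le m; have := r_le n; lra.
exists l => // n; rewrite (norm_distC N_norm); apply: cvg_wrt_le ul _.
by exists n => // m /= nm; apply: le_trans (dist n m nm) _; rewrite lerB.
Qed.

Lemma geometric_cvg_wrt u (c q : R) : complete_wrt N -> 0 <= q < 1 ->
  (forall n, N (u n.+1 - u n) <= c * q ^+ n) ->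
  exists2 l, cvg_wrt u l & forall n, N (u n - l) <= c / (1 - q) * q ^+ n.
Proof.
move=> Nc /andP[q0 q1] uq; pose k := c / (1 - q).
have cE : c = k * (1 - q) by rewrite mulfVK // subr_eq0 gt_eqF.
have kq0 : geometric (- k) q @ \oo --> (0 : R).
  by apply: cvg_geometric; rewrite ger0_norm.
case: (dominated_increments_cvg_wrt Nc _ kq0 (u := u)) => [n|l ul uk].
  by apply: le_trans (uq n) _; rewrite /= cE exprS; lra.
by exists l => // n; have := uk n; rewrite /= sub0r mulNr opprK.
Qed.

End NormConvergence.

Lemma cvg_wrt_biadditive (R : realType) (U V W : lmodType R[i])
    (NU : U -> R) (NV : V -> R) (NW : W -> R) (B : U -> V -> W)
    (u : nat -> U) (v : nat -> V) (a : U) (b : V) :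
  is_norm NU -> is_norm NV -> is_norm NW ->
  (forall x x' y, B (x - x') y = B x y - B x' y) ->
  (forall x y y', B x (y - y') = B x y - B x y') ->
  (forall x y, NW (B x y) <= NU x * NV y) ->
  cvg_wrt NU u a -> cvg_wrt NV v b ->
  cvg_wrt NW (fun n => B (u n) (v n)) (B a b).
Proof.
move=> nU nV nW BBl BBr Ble ua vb.
apply: (cvg_wrt_squeeze nW
  (r := fun n => NU (u n - a) * NV (v n) + NU a * NV (v n - b))) => [|n].
  have -> : 0 = 0 * NV b + NU a * 0 :> R by rewrite mul0r mulr0 addr0.
  exact: cvgD (cvgM ua (cvg_wrt_norm nV vb)) (cvgM (cvg_cst _) vb).
apply: le_trans (norm_dist_triangle nW (B a (v n)) _ _) _.
by rewrite -BBl -BBr lerD.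
Qed.

(** * Positive elements of unital C*-algebras *)

Lemma cstar_norm_star (R : realType) (T : Type) (mul : T -> T -> T)
    (star : T -> T) (N : T -> R) :
  involutive star -> (forall x, 0 <= N x) ->
  (forall x y, N (mul x y) <= N x * N y) ->
  (forall x, N (mul (star x) x) = N x ^+ 2) ->
  forall x, N (star x) = N x.
Proof.
move=> starK N0 NM N2; have le x : N x <= N (star x).
  have := NM (star x) x; rewrite N2 expr2.
  have [x_gt0|x_le0 _] := ltP 0 (N x); first by rewrite ler_pM2r.
  exact: le_trans x_le0 (N0 _).
by move=> x; apply/le_anti; rewrite le andbT -{2}(starK x) le.
Qed.

Section NoncommutativeSquares.
Variables (S : pzRingType) (x y : S).

Lemma subr_sqr_noncomm : x ^+ 2 - y ^+ 2 = x * (x - y) + (x - y) * y.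
Proof. by rewrite mulrBr mulrBl addrA subrK. Qed.

Lemma sqrD_sub_sqrB :
  (x + y) ^+ 2 - (x - y) ^+ 2 = (x * y + y * x) + (x * y + y * x).
Proof.
have sqrD (z : S) : (x + z) ^+ 2 = x ^+ 2 + z ^+ 2 + (x * z + z * x).
  by rewrite expr2 mulrDl !mulrDr [z * x + _]addrC addrACA.
by rewrite !sqrD sqrrN mulrN mulNr -opprD opprB addrC addrA subrK.
Qed.

End NoncommutativeSquares.

HB.mixin Record isUnitalCstar (R : realType) E
    of GRing.Algebra R[i] E := {
  star : E -> E;
  cnorm : E -> R;
  starD : forall x y, star (x + y) = star x + star y;
  starZ : forall (l : R[i]) x, star (l *: x) = conjc l *: star x;
  starK : involutive star;
  starM : forall x y, star (x * y) = star y * star x;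
  cnorm_is_norm : is_norm cnorm;
  cnormM : forall x y, cnorm (x * y) <= cnorm x * cnorm y;
  cnorm_starM : forall x, cnorm (star x * x) = cnorm x ^+ 2;
  cnorm_complete : complete_wrt cnorm }.

#[short(type="unitalCstarType")]
HB.structure Definition UnitalCstar (R : realType) :=
  {E of GRing.Algebra R[i] E & isUnitalCstar R E}.

Section UnitalCstarTheory.
Variables (R : realType) (E : unitalCstarType R).
Implicit Types (x y z g h k : E) (t : R).

Let nE : is_norm (@cnorm R E) := cnorm_is_norm.

Lemma cnorm_ge0 x : 0 <= cnorm x. Proof. exact: norm_ge0 nE x. Qed.

Lemma cnorm_star x : cnorm (star x) = cnorm x.
Proof. exact: cstar_norm_star starK cnorm_ge0 cnormM cnorm_starM x. Qed.

Lemma star0 : star (0 : E) = 0.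
Proof. by apply: (addrI (star 0)); rewrite -starD !addr0. Qed.

Lemma starN x : star (- x) = - star x.
Proof. by rewrite -scaleN1r starZ rmorphN1 scaleN1r. Qed.

Lemma starZ_real t x : star (t%:C *: x) = t%:C *: star x.
Proof. by rewrite starZ conjc_real. Qed.

Lemma star1 : star (1 : E) = 1.
Proof. by rewrite -[LHS]mulr1 -{2}(starK 1) -starM mulr1 starK. Qed.

Definition selfadj x : Prop := star x = x.

Definition bicommutes g y : Prop := forall x, GRing.comm x g -> GRing.comm x y.

Lemma cnormX2 x : cnorm (x ^+ 2) <= cnorm x ^+ 2.
Proof. exact: cnormM. Qed.

Lemma cnorm1_le1 : cnorm (1 : E) <= 1.
Proof.
have := cnorm_starM (1 : E); rewrite star1 mulr1 expr2.
by have := cnorm_ge0 1; nra.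
Qed.

Lemma cnorm_real t : 0 <= t -> cnorm (t%:C%:A : E) <= t.
Proof.
by move=> t0; rewrite (norm_real_scale nE) ger0_norm // ler_piMr // cnorm1_le1.
Qed.

Lemma half_scaleD x : (2^-1)%:C *: (x + x) = x.
Proof.
rewrite -mulr2n -[x *+ 2]scaler_nat -(rmorph_nat (real_complex R)) scalerA.
by rewrite -rmorphM mulVf ?rmorph1 ?scale1r ?pnatr_eq0.
Qed.

Lemma commrZ (l : R[i]) x y : GRing.comm x y -> GRing.comm x (l *: y).
Proof. by move=> xy; rewrite /GRing.comm -scalerAl -scalerAr xy. Qed.

Lemma gram_eq0 x : star x * x = 0 -> x = 0.
Proof.
move=> xx; apply: (norm0_eq0 nE); apply/eqP; rewrite -sqrf_eq0 -cnorm_starM xx.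
by rewrite (norm_zero nE).
Qed.

Lemma selfadj_sqr_eq0 h : selfadj h -> h ^+ 2 = 0 -> h = 0.
Proof. by move=> h_sa h2; apply: gram_eq0; rewrite h_sa. Qed.

Lemma selfadj_sqr h : selfadj h -> selfadj (h ^+ 2).
Proof. by move=> h_sa; rewrite /selfadj expr2 starM h_sa. Qed.

Lemma cnorm_commuting_selfadj_sqr h k : selfadj h -> selfadj k ->
  GRing.comm h k -> cnorm h ^+ 2 <= cnorm (h ^+ 2 + k ^+ 2).
Proof.
move=> h_sa k_sa hk; pose x := h + 'i%C *: k.
have sx : star x = h - 'i%C *: k.
  by rewrite starD starZ h_sa k_sa conjc_i scaleNr.
have -> : h ^+ 2 + k ^+ 2 = star x * x.
  rewrite sx mulrBl !mulrDr -!scalerAl -!scalerAr scalerA -hk opprD addrA addrK.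
  by rewrite -[_ * 'i%C]expr2 sqr_i scaleN1r opprK.
rewrite cnorm_starM lerXn2r ?nnegrE ?cnorm_ge0 //.
rewrite -[h]half_scaleD (norm_real_scale nE) ger0_norm; last by lra.
have -> : h + h = x + star x by rewrite sx addrACA subrr addr0.
by have := norm_triangle nE x (star x); rewrite cnorm_star; lra.
Qed.

Lemma cvg_wrtM (u v : nat -> E) x y : cvg_wrt cnorm u x -> cvg_wrt cnorm v y ->
  cvg_wrt cnorm (fun n => u n * v n) (x * y).
Proof.
apply: cvg_wrt_biadditive nE nE nE _ _ _ => *; last exact: cnormM.
- by rewrite mulrBl.
- by rewrite mulrBr.
Qed.

Lemma cvg_wrt_star (u : nat -> E) x :
  cvg_wrt cnorm u x -> cvg_wrt cnorm (star \o u) (star x).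
Proof.
move=> ux; apply: (cvg_wrt_squeeze nE ux) => n.
by rewrite -starN -starD cnorm_star.
Qed.

End UnitalCstarTheory.

Section SquareRoot.
Variables (R : realType) (E : unitalCstarType R).
Implicit Types (x y g : E).

Let nE : is_norm (@cnorm R E) := cnorm_is_norm.

(* Iterating [y := (g + y^2) / 2] from 0 converges to [1 - sqrt (1 - g)];
   [sqrt_rate] is the scalar case [g = 1], which dominates all increments. *)
Fixpoint sqrt_iter g n : E :=
  if n is m.+1 then (2^-1)%:C *: (g + sqrt_iter g m ^+ 2) else 0.

Fixpoint sqrt_rate n : R :=
  if n is m.+1 then 2^-1 * (1 + sqrt_rate m ^+ 2) else 0.

Lemma sqrt_rate_bounds n : 0 <= sqrt_rate n <= 1.
Proof.
by elim: n => [|n /andP[? ?]] /=; [rewrite lexx ler01|apply/andP; split; nra].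
Qed.

Lemma sqrt_rate_nondecreasing : nondecreasing_seq sqrt_rate.
Proof.
apply/nondecreasing_seqP => n /=.
by have /andP[? ?] := sqrt_rate_bounds n; nra.
Qed.

Lemma is_cvg_sqrt_rate : cvg (sqrt_rate @ \oo).
Proof.
apply: (nondecreasing_is_cvgn sqrt_rate_nondecreasing).
by exists 1 => _ [n _ <-]; have /andP[] := sqrt_rate_bounds n.
Qed.

Lemma cnorm_half x : cnorm ((2^-1)%:C *: x) = 2^-1 * cnorm x.
Proof. by rewrite (norm_real_scale nE) ger0_norm // invr_ge0. Qed.

Lemma cnorm_sqrt_iter g n :
  cnorm g <= 1 -> cnorm (sqrt_iter g n) <= sqrt_rate n.
Proof.
move=> g1; elim: n => [|n IH] /=; first by rewrite norm_zero.
rewrite cnorm_half; have := norm_triangle nE g (sqrt_iter g n ^+ 2).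
have /andP[r0 _] := sqrt_rate_bounds n.
have := lerXn2r 2 (cnorm_ge0 _) r0 IH; have := cnormX2 (sqrt_iter g n); lra.
Qed.

Lemma cnorm_sqrt_iter_step g n : cnorm g <= 1 ->
  cnorm (sqrt_iter g n.+1 - sqrt_iter g n) <= sqrt_rate n.+1 - sqrt_rate n.
Proof.
move=> g1; elim: n => [|n IH].
  by rewrite /= !subr0 !expr0n !addr0 cnorm_half ler_pM2l // invr_gt0.
have iterS m : sqrt_iter g m.+1 = (2^-1)%:C *: (g + sqrt_iter g m ^+ 2) by [].
have rateS m : sqrt_rate m.+1 = 2^-1 * (1 + sqrt_rate m ^+ 2) by [].
rewrite {1}iterS {2}iterS -scalerBr opprD addrACA subrr add0r cnorm_half.
rewrite {1}rateS {2}rateS -mulrBr opprD addrACA subrr add0r.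
rewrite ler_pM2l ?invr_gt0 // !subr_sqr_noncomm.
apply: le_trans (norm_triangle nE _ _) _.
apply: lerD; apply: le_trans (cnormM _ _) _.
  by rewrite ler_pM ?cnorm_ge0 ?cnorm_sqrt_iter.
by rewrite ler_pM ?cnorm_ge0 ?cnorm_sqrt_iter.
Qed.

Lemma selfadj_sqrt_iter g n : selfadj g -> selfadj (sqrt_iter g n).
Proof.
move=> g_sa; elim: n => [|n IH] /=; first exact: star0.
by rewrite /selfadj starZ_real starD selfadj_sqr ?g_sa.
Qed.

Lemma comm_sqrt_iter g x n : GRing.comm x g -> GRing.comm x (sqrt_iter g n).
Proof.
move=> xg; elim: n => [|n IH] /=; first exact: commr0.
by apply/commrZ/commrD/commrX.
Qed.

Lemma exists_sqrt_contraction g : selfadj g -> cnorm g <= 1 ->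
  exists y, [/\ selfadj y, cnorm y <= 1, (1 - y) ^+ 2 = 1 - g &
    bicommutes g y].
Proof.
move=> g_sa g1.
have [y uy _] := dominated_increments_cvg_wrt nE cnorm_complete
  (fun n => cnorm_sqrt_iter_step n g1) is_cvg_sqrt_rate.
have cst x := cvg_wrt_cst nE x.
exists y; split.
- apply: (cvg_wrt_unique nE _ uy); have := cvg_wrt_star uy.
  by congr cvg_wrt; apply/funext => n; rewrite /= selfadj_sqrt_iter.
- rewrite -[y]subr0; apply: (cvg_wrt_le nE uy); apply: nearW => n.
  rewrite subr0; apply: le_trans (cnorm_sqrt_iter n g1) _.
  by have /andP[] := sqrt_rate_bounds n.
- suff yE : y = (2^-1)%:C *: (g + y ^+ 2).
    have y2 : y ^+ 2 = y + y - g.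
      by rewrite {2 3}yE -scalerDr half_scaleD addrC addKr.
    rewrite expr2 mulrBl mul1r mulrBr mulr1 -expr2 y2 opprB.
    by rewrite [y + y - g - y]addrAC addrK addrA subrK.
  have uSy : cvg_wrt cnorm (sqrt_iter g \o succn) y by apply: cvg_wrt_subseq uy.
  apply: (cvg_wrt_unique nE uSy); exact/cvg_wrtZ/cvg_wrtD/cvg_wrtM.
- move=> x xg; apply: (cvg_wrt_unique nE) (cvg_wrtM (cst x) uy) _.
  have := cvg_wrtM uy (cst x).
  by congr cvg_wrt; apply/funext => n; rewrite comm_sqrt_iter.
Qed.

End SquareRoot.

Section PositiveElements.
Variables (R : realType) (E : unitalCstarType R).
Implicit Types (x y g h k c u v : E) (s t : R).

Let nE : is_norm (@cnorm R E) := cnorm_is_norm.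

(* For self-adjoint [x] this says that the spectrum of [x] is contained in
   [[0, 2t]] for some [t]. *)
Definition is_positive x : Prop :=
  selfadj x /\ exists2 t, 0 <= t & cnorm (t%:C%:A - x) <= t.

Lemma selfadj_real t : selfadj (t%:C%:A : E).
Proof. by rewrite /selfadj starZ_real star1. Qed.

Lemma selfadjB x y : selfadj x -> selfadj y -> selfadj (x - y).
Proof. by rewrite /selfadj starD starN => -> ->. Qed.

Lemma selfadjZ t x : selfadj x -> selfadj (t%:C *: x).
Proof. by rewrite /selfadj starZ_real => ->. Qed.

Lemma selfadj_gram x : selfadj (star x * x).
Proof. by rewrite /selfadj starM starK. Qed.

Lemma positiveD x y : is_positive x -> is_positive y -> is_positive (x + y).
Proof.
move=> [x_sa [s s0 xs]] [y_sa [t t0 yt]]; split.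
  by rewrite /selfadj starD x_sa y_sa.
exists (s + t); first exact: addr_ge0.
rewrite rmorphD scalerDl opprD addrACA.
exact: le_trans (norm_triangle nE _ _) (lerD xs yt).
Qed.

Lemma positiveZ t x : 0 <= t -> is_positive x -> is_positive (t%:C *: x).
Proof.
move=> t0 [x_sa [s s0 xs]]; split; first exact: selfadjZ.
exists (t * s); first exact: mulr_ge0.
rewrite rmorphM -scalerA -scalerBr (norm_real_scale nE) ger0_norm //.
exact: ler_wpM2l.
Qed.

Lemma positive_real_sub g t : 0 <= t -> selfadj g -> cnorm g <= t ->
  is_positive (t%:C%:A - g).
Proof.
move=> t0 g_sa gt; split; first exact: selfadjB (selfadj_real t) g_sa.
by exists t; rewrite ?subKr.
Qed.

Lemma exists_sqrt_real_sub g t : 0 <= t -> selfadj g -> cnorm g <= t ->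
  exists v, [/\ is_positive v, v ^+ 2 = t%:C%:A - g & bicommutes g v].
Proof.
move=> t0 g_sa gt; pose g' := t^-1%:C *: g.
have tg' : t%:C *: g' = g.
  rewrite scalerA -rmorphM; have [t_eq0|t_neq0] := eqVneq t 0.
    by rewrite (norm_le0_eq0 nE (_ : cnorm g <= 0)) ?scaler0 // -t_eq0.
  by rewrite mulfV // rmorph1 scale1r.
have g'1 : cnorm g' <= 1.
  rewrite (norm_real_scale nE) ger0_norm ?invr_ge0 //.
  have [->|t_neq0] := eqVneq t 0; first by rewrite invr0 mul0r.
  by rewrite ler_pdivrMl ?mulr1 // lt0r t_neq0.
have [y [y_sa y1 y2 yc]] := exists_sqrt_contraction (selfadjZ _ g_sa) g'1.
have rt0 := sqrtr_ge0 t; exists ((Num.sqrt t)%:C *: (1 - y)); split.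
- rewrite scalerBr; apply: positive_real_sub => //; first exact: selfadjZ.
  by rewrite (norm_real_scale nE) ger0_norm // ler_piMr.
- rewrite exprZn y2 -rmorphXn sqr_sqrtr //.
  by rewrite scalerBr tg'.
- by move=> x xg; apply/commrZ/commrB/yc/commrZ/xg/commr1.
Qed.

Lemma exists_positive_sqrt h : is_positive h ->
  exists u, [/\ is_positive u, u ^+ 2 = h & bicommutes h u].
Proof.
move=> [h_sa [t t0 ht]].
have th_sa := selfadjB (selfadj_real t) h_sa.
have [u [u_pos u2 uc]] := exists_sqrt_real_sub t0 th_sa ht.
exists u; split=> [//||x xh]; first by rewrite u2 subKr.
by apply/uc/commrB/xh/commrZ/commr1.
Qed.

Lemma positive_sqr h : selfadj h -> is_positive (h ^+ 2).
Proof.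
move=> h_sa; have t0 := cnorm_ge0 (h ^+ 2); set t := cnorm _ in t0.
have h2_sa := selfadj_sqr h_sa.
have [v [[v_sa _] v2 vc]] := exists_sqrt_real_sub t0 h2_sa (lexx t).
split=> //.
exists t => //; rewrite -v2; apply: le_trans (cnormX2 v) _.
have hv : GRing.comm v h by apply/commr_sym/vc/commrX/commr_refl.
apply: le_trans (cnorm_commuting_selfadj_sqr v_sa h_sa hv) _.
by rewrite v2 subrK cnorm_real.
Qed.

Lemma cnorm_le_positiveD h k :
  is_positive h -> is_positive k -> cnorm h <= cnorm (h + k).
Proof.
move=> h_pos k_pos; have s0 := cnorm_ge0 (h + k); set s := cnorm _ in s0 *.
have [u [[u_sa _] u2 uc]] := exists_positive_sqrt h_pos.
have m_pos : is_positive (s%:C%:A - h).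
  have -> : s%:C%:A - h = k + (s%:C%:A - (h + k)).
    by rewrite opprD [k + _]addrC addrA subrK.
  apply: positiveD (positive_real_sub _ _ _) => //.
  by have [[]] := positiveD h_pos k_pos.
have [v [[v_sa _] v2 vc]] := exists_positive_sqrt m_pos.
have uv : GRing.comm u v.
  apply: vc; apply: commrB; first exact/commrZ/commr1.
  by rewrite -u2; apply/commrX/commr_refl.
rewrite -{1}u2; apply: le_trans (cnormX2 u) _.
apply: le_trans (cnorm_commuting_selfadj_sqr u_sa v_sa uv) _.
by rewrite u2 v2 subrKC cnorm_real.
Qed.

Lemma positive_opp_eq0 h : is_positive h -> is_positive (- h) -> h = 0.
Proof.
move=> h_pos hN_pos; apply: (norm_le0_eq0 nE).
by have := cnorm_le_positiveD h_pos hN_pos; rewrite subrr norm_zero.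
Qed.

Lemma positive_gram_swap c :
  is_positive (- (star c * c)) -> is_positive (c * star c).
Proof.
move=> c_neg; set a := c + star c; set b := 'i%C *: (c - star c).
have a_sa : selfadj a by rewrite /selfadj starD starK addrC.
have b_sa : selfadj b.
  rewrite /selfadj starZ starD starN starK -opprB.
  by rewrite conjc_i scaleNr scalerN opprK.
have -> : c * star c = (2^-1)%:C *: (a ^+ 2 + b ^+ 2) - star c * c.
  have -> : a ^+ 2 + b ^+ 2 =
      (c * star c + star c * c) + (c * star c + star c * c).
    by rewrite exprZn sqr_i scaleN1r sqrD_sub_sqrB.
  by rewrite half_scaleD addrK.
apply: positiveD c_neg; apply: positiveZ; first by lra.
by apply: positiveD; apply: positive_sqr.
Qed.

(* Kaplansky's argument, applied to [c] and to [c * k] with [k] the square root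
   of [- star c * c]: both [(c * star c) ^+ 2] and its opposite, the gram swap of
   [c * k], are positive. *)
Lemma negative_gram_eq0 c : is_positive (- (star c * c)) -> c = 0.
Proof.
move=> c_neg; have [k [[k_sa _] k2 _]] := exists_positive_sqrt c_neg.
have [p_sa _] := positive_gram_swap c_neg; set p := c * star c in p_sa.
have ck : - (star (c * k) * (c * k)) = (k ^+ 2) ^+ 2.
  rewrite starM k_sa -mulrA (mulrA (star c)) -[star c * c]opprK -k2.
  by rewrite mulNr mulrN opprK !expr2 !mulrA.
have kc : c * k * star (c * k) = - p ^+ 2.
  by rewrite starM k_sa -mulrA (mulrA k) -expr2 k2 mulNr mulrN /p expr2 !mulrA.
have p2 : p ^+ 2 = 0.
  apply: positive_opp_eq0 (positive_sqr p_sa) _; rewrite -kc.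
  by apply: positive_gram_swap; rewrite ck; apply/positive_sqr/selfadj_sqr.
have sc0 : star c = 0.
  by apply: gram_eq0; rewrite starK; exact: selfadj_sqr_eq0 p_sa p2.
by rewrite -[c]starK sc0 star0.
Qed.

(* With [w = |h|], the element [n = w - h] is twice the negative part of [h]. *)
Lemma positive_gram x : is_positive (star x * x).
Proof.
set h := star x * x; have h_sa : selfadj h := selfadj_gram x.
have [w [w_pos w2 wc]] := exists_positive_sqrt (positive_sqr h_sa).
have [r [[r_sa _] r2 rc]] := exists_positive_sqrt w_pos; have [w_sa _] := w_pos.
have hw : GRing.comm h w by apply/wc/commrX/commr_refl.
pose n := w - h; have n_sa : selfadj n := selfadjB w_sa h_sa.
have nh : n * h = - (n * w).
  by rewrite /n !mulrBl -!expr2 w2 -hw opprB.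
have nr : GRing.comm n r.
  by apply/rc/commr_sym/commrB; [apply: commr_refl|apply: commr_sym].
have nr_sa : selfadj (n * r) by rewrite /selfadj starM n_sa r_sa.
have xn : x * n = 0.
  apply: negative_gram_eq0; suff -> : - (star (x * n) * (x * n)) = (n * r) ^+ 2.
    exact: positive_sqr.
  rewrite starM n_sa -mulrA (mulrA (star x)) -/h mulrA nh mulNr opprK.
  by rewrite -r2 !expr2 -!mulrA -nr.
have nh0 : n * h = 0 by rewrite -h_sa -n_sa -starM /h -mulrA xn mulr0 star0.
suff n0 : n = 0 by have -> : h = w by apply/esym/subr0_eq.
apply: selfadj_sqr_eq0 n_sa _; rewrite expr2 [in X in _ * X]/n mulrBr nh0 subr0.
by apply: oppr_inj; rewrite -nh nh0 oppr0.
Qed.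

End PositiveElements.

(** * The algebra of adjointable operators *)

Section CStarAlgebra.
Variables (R : realType) (A : cstar_alg R).
Implicit Types (a b c : A) (l : R[i]).

Let ax := ca_ax A.

Lemma ca_mulA a b c : ca_mul a (ca_mul b c) = ca_mul (ca_mul a b) c.
Proof. by move: ax => -[]. Qed.
Lemma ca_mulDl a b c : ca_mul (a + b) c = ca_mul a c + ca_mul b c.
Proof. by move: ax => -[_ []]. Qed.
Lemma ca_mulDr a b c : ca_mul a (b + c) = ca_mul a b + ca_mul a c.
Proof. by move: ax => -[_ [_ []]]. Qed.
Lemma ca_mulZl l a b : ca_mul (l *: a) b = l *: ca_mul a b.
Proof. by move: ax => -[_ [_ [_ [/(_ l a b)[]]]]]. Qed.
Lemma ca_mulZr l a b : ca_mul a (l *: b) = l *: ca_mul a b.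
Proof. by move: ax => -[_ [_ [_ [/(_ l a b)[]]]]]. Qed.
Lemma ca_starD a b : ca_star (a + b) = ca_star a + ca_star b.
Proof. by move: ax => -[_ [_ [_ [_ []]]]]. Qed.
Lemma ca_starZ l a : ca_star (l *: a) = conjc l *: ca_star a.
Proof. by move: ax => -[_ [_ [_ [_ [_ []]]]]]. Qed.
Lemma ca_starK : involutive (@ca_star R A).
Proof. by move: ax => -[_ [_ [_ [_ [_ [_ []]]]]]]. Qed.
Lemma ca_starM a b : ca_star (ca_mul a b) = ca_mul (ca_star b) (ca_star a).
Proof. by move: ax => -[_ [_ [_ [_ [_ [_ [_ []]]]]]]]. Qed.

Lemma ca_is_norm : is_norm (@ca_norm R A).
Proof. by move: ax => -[_ [_ [_ [_ [_ [_ [_ [_ [_ [? [? [? _]]]]]]]]]]]]; split. Qed.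
Lemma ca_normM a b : ca_norm (ca_mul a b) <= ca_norm a * ca_norm b.
Proof. by move: ax => -[_ [_ [_ [_ [_ [_ [_ [_ [_ [_ [_ [_ []]]]]]]]]]]]]. Qed.
Lemma ca_norm_starM a : ca_norm (ca_mul (ca_star a) a) = ca_norm a ^+ 2.
Proof. by move: ax => -[_ [_ [_ [_ [_ [_ [_ [_ [_ [_ [_ [_ [_ []]]]]]]]]]]]]]. Qed.
Lemma ca_complete : complete_wrt (@ca_norm R A).
Proof. by case: ax => [_ [_ [_ [_ [_ [_ [_ [_ [_ [_ [_ [_ [_ [_ ?]]]]]]]]]]]]]]. Qed.

Lemma ca_norm_ge0 a : 0 <= ca_norm a.
Proof. exact: norm_ge0 ca_is_norm a. Qed.

Lemma ca_norm_star a : ca_norm (ca_star a) = ca_norm a.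
Proof.
exact: cstar_norm_star ca_starK ca_norm_ge0 ca_normM ca_norm_starM a.
Qed.

Lemma ca_mulNr a b : ca_mul (- a) b = - ca_mul a b.
Proof. by rewrite -scaleN1r ca_mulZl scaleN1r. Qed.
Lemma ca_mulrN a b : ca_mul a (- b) = - ca_mul a b.
Proof. by rewrite -scaleN1r ca_mulZr scaleN1r. Qed.
Lemma ca_starN a : ca_star (- a) = - ca_star a.
Proof. by rewrite -scaleN1r ca_starZ rmorphN1 scaleN1r. Qed.

Lemma cvg_wrt_starM (u v : nat -> A) a b :
  cvg_wrt (@ca_norm R A) u a -> cvg_wrt (@ca_norm R A) v b ->
  cvg_wrt (@ca_norm R A) (fun n => ca_mul (ca_star (u n)) (v n))
    (ca_mul (ca_star a) b).
Proof.
have nA := ca_is_norm.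
apply: (cvg_wrt_biadditive (B := fun x y => ca_mul (ca_star x) y) nA nA nA).
- by move=> x x' y; rewrite ca_starD ca_starN ca_mulDl ca_mulNr.
- by move=> x y y'; rewrite ca_mulDr ca_mulrN.
- by move=> x y; rewrite -(ca_norm_star x) ca_normM.
Qed.

Lemma ca_starM_inj a b :
  (forall c, ca_mul (ca_star a) c = ca_mul (ca_star b) c) -> a = b.
Proof.
move=> ab; apply/subr0_eq/(norm0_eq0 ca_is_norm)/eqP.
rewrite -sqrf_eq0 -ca_norm_starM ca_starD ca_starN ca_mulDl ab ca_mulNr subrr.
by rewrite (norm_zero ca_is_norm).
Qed.

Lemma ca_starM_injr a b :
  (forall c, ca_mul (ca_star c) a = ca_mul (ca_star c) b) -> a = b.
Proof.
move=> ab; apply: ca_starM_inj => c.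
by apply: (can_inj ca_starK); rewrite !ca_starM !ca_starK.
Qed.

End CStarAlgebra.

Lemma uniform_cauchy_limit (R : realType) (U : Type) (V : lmodType R[i])
    (M : U -> R) (N : V -> R) (w : nat -> U -> V) :
  is_norm N -> complete_wrt N -> (forall x, 0 <= M x) ->
  (forall e, 0 < e -> exists K, forall m n, (K <= m)%N -> (K <= n)%N ->
     forall x, N (w m x - w n x) <= e * M x) ->
  exists2 l : U -> V, forall x, cvg_wrt N (w ^~ x) (l x) &
    forall e, 0 < e -> exists K, forall n, (K <= n)%N ->
      forall x, N (w n x - l x) <= e * M x.
Proof.
move=> nN Nc M0 wc.
have /choice[l wl] x : exists y, cvg_wrt N (w ^~ x) y.
  case: (Nc (w ^~ x)) => [e e0|y /(cvg_wrtP nN) wy]; last by exists y.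
  have Mx1 : 0 < M x + 1 by rewrite ltr_wpDl.
  have [K Ke] := wc (e / (M x + 1)) (divr_gt0 e0 Mx1).
  exists K => m n Km Kn; apply: le_lt_trans (Ke m n Km Kn x) _.
  by rewrite mulrAC ltr_pdivrMr // ltr_pM2l // ltrDl.
exists l => [//|e /wc [K Ke]]; exists K => n Kn x; rewrite (norm_distC nN).
by apply: (cvg_wrt_le nN (wl x)); exists K => // m /= Km; apply: Ke.
Qed.

Definition bounded_by (R : realType) (A : cstar_alg R) (f : A -> A) (c : R)
  : Prop :=
  forall a, ca_norm (f a) <= c * ca_norm a.

Record adjop (R : realType) (A : cstar_alg R) := AdjOp {
  op_fun :> A -> A;
  op_adj : A -> A;
  op_adjP : forall a b,
    ca_mul (ca_star (op_fun a)) b = ca_mul (ca_star a) (op_adj b);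
  op_bounded : exists2 c, 0 <= c & bounded_by op_fun c }.

Section AdjointableOperators.
Variables (R : realType) (A : cstar_alg R).
Implicit Types (T S : adjop A) (a b : A) (l : R[i]) (c : R).

Let nA : is_norm (@ca_norm R A) := ca_is_norm A.

Lemma op_adj_adjP T a b :
  ca_mul (ca_star (op_adj T a)) b = ca_mul (ca_star a) (T b).
Proof.
by apply: (can_inj (@ca_starK _ A)); rewrite !ca_starM !ca_starK op_adjP.
Qed.

Lemma adjop_ext T S : T =1 S -> T = S.
Proof.
move=> TS; have adjTS : op_adj T =1 op_adj S.
  by move=> a; apply: ca_starM_injr => c; rewrite -!op_adjP TS.
case: T S TS adjTS => [f g fP fB] [f' g' fP' fB'] /= /funext ff /funext gg.
by rewrite -{}ff -{}gg in fP' fB' *; congr AdjOp; apply: Prop_irrelevance.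
Qed.

Lemma op_funD T a b : T (a + b) = T a + T b.
Proof.
by apply: ca_starM_inj => c; rewrite op_adjP !ca_starD !ca_mulDl !op_adjP.
Qed.

Lemma op_funZ T l a : T (l *: a) = l *: T a.
Proof.
by apply: ca_starM_inj => c; rewrite op_adjP !ca_starZ !ca_mulZl !op_adjP.
Qed.

Lemma op_adj_bounded_by T c : bounded_by T c -> bounded_by (op_adj T) c.
Proof.
move=> Tc a; have [adj_gt0|adj_le0] := ltP 0 (ca_norm (op_adj T a)); last first.
  by apply: le_trans adj_le0 (le_trans (ca_norm_ge0 (T a)) (Tc a)).
rewrite -(ler_pM2r adj_gt0) -expr2 -ca_norm_starM op_adj_adjP.
apply: le_trans (ca_normM _ _) _; rewrite ca_norm_star mulrC mulrAC.
by apply: ler_wpM2r (Tc _); apply: ca_norm_ge0.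
Qed.

Fact op_adj_bounded T :
  exists2 c, 0 <= c & bounded_by (op_adj T) c.
Proof. by have [c c0 /op_adj_bounded_by] := op_bounded T; exists c. Qed.

Definition adjop_star T : adjop A := AdjOp (op_adj_adjP T) (op_adj_bounded T).

Program Definition adjop_scalar l : adjop A :=
  @AdjOp R A (fun a => l *: a) (fun a => conjc l *: a) _ _.
Next Obligation. by move=> l a b /=; rewrite ca_starZ ca_mulZl ca_mulZr. Qed.
Next Obligation.
by move=> l; exists (cabs l) => [|a /=]; rewrite ?cabs_ge0 ?(norm_scale nA).
Qed.

Program Definition adjop_add T S : adjop A :=
  @AdjOp R A (fun a => T a + S a) (fun a => op_adj T a + op_adj S a) _ _.
Next Obligation.
by move=> T S a b /=; rewrite ca_starD ca_mulDl ca_mulDr !op_adjP.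
Qed.
Next Obligation.
move=> T S; have [[c c0 Tc] [d d0 Sd]] := (op_bounded T, op_bounded S).
exists (c + d) => [|a]; first exact: addr_ge0.
by rewrite mulrDl; apply: le_trans (norm_triangle nA _ _) (lerD (Tc a) (Sd a)).
Qed.

Program Definition adjop_comp T S : adjop A :=
  @AdjOp R A (fun a => T (S a)) (fun a => op_adj S (op_adj T a)) _ _.
Next Obligation. by move=> T S a b /=; rewrite !op_adjP. Qed.
Next Obligation.
move=> T S; have [[c c0 Tc] [d d0 Sd]] := (op_bounded T, op_bounded S).
exists (c * d) => [|a]; first exact: mulr_ge0.
by apply: le_trans (Tc _) _; rewrite -mulrA ler_wpM2l.
Qed.

Program Definition adjop_lmul a : adjop A :=
  @AdjOp R A (fun b => ca_mul a b) (fun b => ca_mul (ca_star a) b) _ _.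
Next Obligation. by move=> a b c /=; rewrite ca_starM ca_mulA. Qed.
Next Obligation.
by move=> a; exists (ca_norm a) => [|b /=]; rewrite ?ca_norm_ge0 ?ca_normM.
Qed.

Definition opnorm T : R :=
  inf [set c | 0 <= c /\ bounded_by T c].

Lemma opnorm_le T c :
  0 <= c -> bounded_by T c -> opnorm T <= c.
Proof. by move=> c0 Tc; apply: ge_inf => //; exists 0 => d []. Qed.

Lemma opnorm_ge0 T : 0 <= opnorm T.
Proof.
by apply: lb_le_inf => [|c []//]; have [c c0 Tc] := op_bounded T; exists c.
Qed.

Lemma ca_norm_op T : bounded_by T (opnorm T).
Proof.
move=> a; have [c c0 Tc] := op_bounded T.
have [a_gt0|a_le0] := ltP 0 (ca_norm a); last first.
  by have := Tc a; rewrite (norm_le0_eq0 nA a_le0) (norm_zero nA) !mulr0.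
rewrite -ler_pdivrMr //; apply: lb_le_inf => [|d [_ Td]]; first by exists c.
by rewrite ler_pdivrMr.
Qed.

Lemma opnorm_star T : opnorm (adjop_star T) <= opnorm T.
Proof. by apply: opnorm_le (opnorm_ge0 T) _; apply/op_adj_bounded_by/ca_norm_op. Qed.

Lemma opnorm_comp T S : opnorm (adjop_comp T S) <= opnorm T * opnorm S.
Proof.
apply: opnorm_le => [|a /=]; first by rewrite mulr_ge0 ?opnorm_ge0.
apply: le_trans (ca_norm_op _ _) _.
by rewrite -mulrA ler_wpM2l ?opnorm_ge0 ?ca_norm_op.
Qed.

Lemma opnorm_star_comp T : opnorm (adjop_comp (adjop_star T) T) = opnorm T ^+ 2.
Proof.
apply/le_anti/andP; split.
  apply: le_trans (opnorm_comp _ _) _.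
  by rewrite expr2 ler_wpM2r ?opnorm_ge0 ?opnorm_star.
have d0 := opnorm_ge0 (adjop_comp (adjop_star T) T).
rewrite -[leRHS]sqr_sqrtr // ler_pXn2r ?nnegrE ?sqrtr_ge0 ?opnorm_ge0 //.
apply: opnorm_le => [|a]; first exact: sqrtr_ge0.
rewrite -(@ler_pXn2r _ 2) ?nnegrE ?mulr_ge0 ?sqrtr_ge0 ?ca_norm_ge0 //.
rewrite exprMn sqr_sqrtr // -ca_norm_starM op_adjP.
apply: le_trans (ca_normM _ _) _; rewrite ca_norm_star expr2 mulrCA.
apply: ler_wpM2l; first exact: ca_norm_ge0.
exact: (ca_norm_op (adjop_comp (adjop_star T) T) a).
Qed.

Lemma opnorm_lmul a : opnorm (adjop_lmul a) = ca_norm a.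
Proof.
apply/le_anti/andP; split.
  by apply: opnorm_le => [|b]; [exact: ca_norm_ge0|exact: ca_normM].
have := ca_norm_op (adjop_lmul a) (ca_star a); rewrite /= -{1}(ca_starK a).
rewrite ca_norm_starM ca_norm_star expr2.
have [a_gt0|a_le0 _] := ltP 0 (ca_norm a); first by rewrite ler_pM2r.
exact: le_trans a_le0 (opnorm_ge0 _).
Qed.

End AdjointableOperators.

(* The algebras of the library are nontrivial rings, whence the phantom
   nontriviality proof. *)
Definition multiplier (R : realType) (A : cstar_alg R)
  (_ : exists a : A, a != 0) : Type := adjop A.

Section MultiplierAlgebra.
Variables (R : realType) (A : cstar_alg R) (A_neq0 : exists a : A, a != 0).
Local Notation M := (multiplier A_neq0).
Implicit Types (T S : M) (l : R[i]).

Let nA : is_norm (@ca_norm R A) := ca_is_norm A.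

HB.instance Definition _ := gen_eqMixin M.
HB.instance Definition _ := gen_choiceMixin M.

Definition multiplier_scale l T : M := adjop_comp (adjop_scalar A l) T.
Local Notation scale := multiplier_scale.

Fact multiplier_addA : associative (@adjop_add R A).
Proof. by move=> T S U; apply: adjop_ext => a /=; rewrite addrA. Qed.
Fact multiplier_addC : commutative (@adjop_add R A).
Proof. by move=> T S; apply: adjop_ext => a /=; rewrite addrC. Qed.
Fact multiplier_add0 : left_id (adjop_scalar A 0) (@adjop_add R A).
Proof. by move=> T; apply: adjop_ext => a /=; rewrite scale0r add0r. Qed.
Fact multiplier_addN :
  left_inverse (adjop_scalar A 0) (scale (-1)) (@adjop_add R A).
Proof.
by move=> T; apply: adjop_ext => a /=; rewrite scaleN1r scale0r addNr.
Qed.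
HB.instance Definition _ := GRing.isZmodule.Build M
  multiplier_addA multiplier_addC multiplier_add0 multiplier_addN.

Fact multiplier_mulA : associative (@adjop_comp R A).
Proof. by move=> T S U; apply: adjop_ext. Qed.
Fact multiplier_mul1l : left_id (adjop_scalar A 1) (@adjop_comp R A).
Proof. by move=> T; apply: adjop_ext => a /=; rewrite scale1r. Qed.
Fact multiplier_mul1r : right_id (adjop_scalar A 1) (@adjop_comp R A).
Proof. by move=> T; apply: adjop_ext => a /=; rewrite scale1r. Qed.
Fact multiplier_mulDl : left_distributive (@adjop_comp R A) (@adjop_add R A).
Proof. by move=> T S U; apply: adjop_ext. Qed.
Fact multiplier_mulDr : right_distributive (@adjop_comp R A) (@adjop_add R A).
Proof. by move=> T S U; apply: adjop_ext => a /=; rewrite op_funD. Qed.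
Fact multiplier_one_neq0 : adjop_scalar A 1 != 0 :> M.
Proof.
apply/eqP => /(congr1 (@op_fun R A)) one0; have [a /eqP[]] := A_neq0.
by have := congr1 (@^~ a) one0; rewrite /= scale0r scale1r.
Qed.
HB.instance Definition _ := GRing.Zmodule_isNzRing.Build M
  multiplier_mulA multiplier_mul1l multiplier_mul1r multiplier_mulDl
  multiplier_mulDr multiplier_one_neq0.

Fact multiplier_scaleA l m T : scale l (scale m T) = scale (l * m) T.
Proof. by apply: adjop_ext => a /=; rewrite scalerA. Qed.
Fact multiplier_scale1 : left_id 1 scale.
Proof. exact: multiplier_mul1l. Qed.
Fact multiplier_scaleDr : right_distributive scale +%R.
Proof. by move=> l; apply: multiplier_mulDr. Qed.
Fact multiplier_scaleDl T : {morph scale^~ T : l m / l + m}.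
Proof. by move=> l m; apply: adjop_ext => a /=; rewrite scalerDl. Qed.
HB.instance Definition _ := GRing.Zmodule_isLmodule.Build R[i] M
  multiplier_scaleA multiplier_scale1 multiplier_scaleDr multiplier_scaleDl.

Fact multiplier_scaleAl l T S : l *: (T * S) = l *: T * S.
Proof. exact: multiplier_mulA. Qed.
HB.instance Definition _ :=
  GRing.Lmodule_isLalgebra.Build R[i] M multiplier_scaleAl.

Fact multiplier_scaleAr l T S : l *: (T * S) = T * (l *: S).
Proof. by apply: adjop_ext => a /=; rewrite op_funZ. Qed.
HB.instance Definition _ :=
  GRing.Lalgebra_isAlgebra.Build R[i] M multiplier_scaleAr.

Definition multiplier_star T : M := adjop_star T.
Local Notation star := multiplier_star.

Fact multiplier_starD T S : star (T + S) = star T + star S.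
Proof. exact: adjop_ext. Qed.
Fact multiplier_starZ l T : star (l *: T) = conjc l *: star T.
Proof. by apply: adjop_ext => a /=; rewrite -(op_funZ (adjop_star T)). Qed.
Fact multiplier_starK : involutive star.
Proof. by move=> T; apply: adjop_ext. Qed.
Fact multiplier_starM T S : star (T * S) = star S * star T.
Proof. exact: adjop_ext. Qed.

Fact multiplier_is_norm : is_norm (@opnorm R A : M -> R).
Proof.
have leZ l T : opnorm (l *: T : M) <= cabs l * opnorm T.
  apply: opnorm_le => [|a /=]; first by rewrite mulr_ge0 ?cabs_ge0 ?opnorm_ge0.
  by rewrite (norm_scale nA) -mulrA ler_wpM2l ?cabs_ge0 ?ca_norm_op.
split=> [T T0|T S|l T].
- apply: adjop_ext => a /=; rewrite scale0r; apply: (norm_le0_eq0 nA).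
  by rewrite -(mul0r (ca_norm a)) -T0 ca_norm_op.
- apply: opnorm_le => [|a]; first by rewrite addr_ge0 ?opnorm_ge0.
  rewrite mulrDl; apply: le_trans (norm_triangle nA _ _) _.
  by rewrite lerD ?ca_norm_op.
- apply/le_anti; rewrite leZ /=; have [l0|l_gt0] := leP (cabs l) 0.
    by rewrite (le_trans _ (opnorm_ge0 _)) // mulr_le0_ge0 ?opnorm_ge0.
  rewrite mulrC -ler_pdivlMr //.
  apply: opnorm_le => [|a]; first by rewrite divr_ge0 ?opnorm_ge0 ?ltW.
  rewrite mulrAC ler_pdivlMr // mulrC -(norm_scale nA).
  exact: (ca_norm_op (l *: T : M)).
Qed.

Definition op_cauchy (w : nat -> M) : Prop := forall e, 0 < e ->
  exists K, forall m n, (K <= m)%N -> (K <= n)%N -> opnorm (w m - w n) < e.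

Lemma op_cauchy_star (w : nat -> M) : op_cauchy w -> op_cauchy (star \o w).
Proof.
move=> w_cauchy e /w_cauchy [K Ke]; exists K => m n Km Kn.
apply: le_lt_trans (Ke m n Km Kn) => /=.
have -> : star (w m) - star (w n) = star (w m - w n).
  rewrite -(scaleN1r (w n)) multiplier_starD multiplier_starZ.
  by rewrite rmorphN1 scaleN1r.
exact: opnorm_star.
Qed.

Lemma op_cauchy_limit (w : nat -> M) : op_cauchy w ->
  exists2 s : A -> A, forall a, cvg_wrt (@ca_norm R A) (w ^~ a) (s a) &
    forall e, 0 < e -> exists K, forall n, (K <= n)%N ->
      bounded_by (fun a => w n a - s a) e.
Proof.
move=> w_cauchy; apply: (uniform_cauchy_limit nA (@ca_complete _ A)) => [a|e].
  exact: ca_norm_ge0.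
move=> /w_cauchy [K Ke]; exists K => m n Km Kn a.
rewrite -scaleN1r; apply: le_trans (ca_norm_op (w m - w n : M) a) _.
by rewrite ler_wpM2r ?ca_norm_ge0 ?ltW ?Ke.
Qed.

Fact multiplier_complete : complete_wrt (@opnorm R A : M -> R).
Proof.
move=> u u_cauchy; have [t ut t_unif] := op_cauchy_limit u_cauchy.
have [s us _] := op_cauchy_limit (op_cauchy_star u_cauchy).
have adj a b : ca_mul (ca_star (t a)) b = ca_mul (ca_star a) (s b).
  have cst c := cvg_wrt_cst nA c.
  apply: (cvg_wrt_unique nA (cvg_wrt_starM (ut a) (cst b))).
  have := cvg_wrt_starM (cst a) (us b).
  by congr cvg_wrt; apply/funext => n /=; rewrite -op_adjP.
have [K tK] := t_unif 1 ltr01.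
have t_bounded : exists2 c, 0 <= c & bounded_by t c.
  exists (opnorm (u K) + 1) => [|a]; first by rewrite addr_ge0 ?opnorm_ge0.
  have := norm_triangle nA (t a - u K a) (u K a).
  rewrite subrK (norm_distC nA) => /le_trans; apply.
  by rewrite addrC mulrDl lerD ?ca_norm_op ?tK.
exists (AdjOp adj t_bounded) => e e0.
have [|K' tK'] := t_unif (e / 2); first by lra.
exists K' => n /tK' ute; apply: (@le_lt_trans _ _ (e / 2)); last by lra.
apply: opnorm_le => [|a]; first by lra.
by apply: le_trans (ute a); rewrite /= scaleN1r.
Qed.

Fact multiplier_normM T S : opnorm (T * S : M) <= opnorm T * opnorm S.
Proof. exact: opnorm_comp. Qed.

HB.instance Definition _ := isUnitalCstar.Build R M
  multiplier_starD multiplier_starZ multiplier_starK multiplier_starM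
  multiplier_is_norm multiplier_normM (@opnorm_star_comp R A)
  multiplier_complete.

End MultiplierAlgebra.

Section PositivityInCStarAlgebras.
Variables (R : realType) (A : cstar_alg R).
Implicit Types (h k : A).

Lemma ca_positiveZ (t : R) h :
  0 <= t -> ca_positive h -> ca_positive (t%:C *: h).
Proof.
move=> t0 [b ->]; exists ((Num.sqrt t)%:C *: b).
rewrite ca_starZ conjc_real ca_mulZl ca_mulZr scalerA -rmorphM -expr2.
by rewrite sqr_sqrtr.
Qed.

Lemma ca_norm_le_positiveD h k : ca_positive h -> ca_positive k ->
  ca_norm h <= ca_norm (h + k).
Proof.
move=> [b ->] [d ->].
have [A_neq0|A_eq0] := pselect (exists a : A, a != 0); last first.
  have eq0 (a : A) : a = 0.
    by apply/eqP/negP => /negP a0; apply: A_eq0; exists a.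
  by rewrite [X in ca_norm X]eq0 [X in _ <= ca_norm X]eq0.
pose lmul a : multiplier A_neq0 := adjop_lmul a.
have gram a : lmul (ca_mul (ca_star a) a) = star (lmul a) * lmul a.
  by apply: adjop_ext => c /=; rewrite ca_mulA.
have lmulD a a' : lmul (a + a') = lmul a + lmul a'.
  by apply: adjop_ext => c /=; rewrite ca_mulDl.
have := cnorm_le_positiveD (positive_gram (lmul b)) (positive_gram (lmul d)).
have normE a : cnorm (lmul a) = ca_norm a := opnorm_lmul a.
by rewrite -!gram -lmulD !normE.
Qed.

End PositivityInCStarAlgebras.

(** * Hilbert modules *)

Section HilbertModule.
Variables (R : realType) (A : cstar_alg R) (X : hmod A).
Implicit Types (x y z : X) (a b : A) (l : R[i]).

Let ax := hm_ax X.

Lemma hm_actDl a b x : hm_act (a + b) x = hm_act a x + hm_act b x.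
Proof. by case: ax. Qed.
Lemma hm_actDr a x y : hm_act a (x + y) = hm_act a x + hm_act a y.
Proof. by case: ax => _ []. Qed.
Lemma hm_actZl l a x : hm_act (l *: a) x = l *: hm_act a x.
Proof. by case: ax => _ [_ [_ [/(_ l a x)[-> _]]]]. Qed.
Lemma hm_actZr l a x : hm_act a (l *: x) = l *: hm_act a x.
Proof. by case: ax => _ [_ [_ [/(_ l a x)[_ ->]]]]. Qed.
Lemma hm_ipDl x y z : hm_ip (x + y) z = hm_ip x z + hm_ip y z.
Proof. by case: ax => _ [_ [_ [_ []]]]. Qed.
Lemma hm_ipZl l x y : hm_ip (l *: x) y = l *: hm_ip x y.
Proof. by case: ax => _ [_ [_ [_ [_ []]]]]. Qed.
Lemma hm_ip_actl a x y : hm_ip (hm_act a x) y = ca_mul a (hm_ip x y).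
Proof. by case: ax => _ [_ [_ [_ [_ [_ []]]]]]. Qed.
Lemma hm_ip_star x y : ca_star (hm_ip x y) = hm_ip y x.
Proof. by case: ax => _ [_ [_ [_ [_ [_ [_ []]]]]]]. Qed.
Lemma hm_ip_positive x : ca_positive (hm_ip x x).
Proof. by case: ax => _ [_ [_ [_ [_ [_ [_ [_ [? _]]]]]]]]. Qed.
Lemma hm_ip_eq0 x : hm_ip x x = 0 -> x = 0.
Proof. by case: ax => _ [_ [_ [_ [_ [_ [_ [_ [_ [/(_ x)[? _] _]]]]]]]]]. Qed.
Lemma hm_complete : complete_wrt (@hm_norm R A X).
Proof. by case: ax => _ [_ [_ [_ [_ [_ [_ [_ [_ [_ ?]]]]]]]]]. Qed.

Lemma hm_actNr a x : hm_act (- a) x = - hm_act a x.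
Proof. by rewrite -scaleN1r hm_actZl scaleN1r. Qed.
Lemma hm_actrN a x : hm_act a (- x) = - hm_act a x.
Proof. by rewrite -scaleN1r hm_actZr scaleN1r. Qed.
Lemma hm_ipNr x y : hm_ip (- x) y = - hm_ip x y.
Proof. by rewrite -scaleN1r hm_ipZl scaleN1r. Qed.
Lemma hm_ipDr x y z : hm_ip x (y + z) = hm_ip x y + hm_ip x z.
Proof. by rewrite -hm_ip_star hm_ipDl ca_starD !hm_ip_star. Qed.
Lemma hm_ipZr l x y : hm_ip x (l *: y) = conjc l *: hm_ip x y.
Proof. by rewrite -hm_ip_star hm_ipZl ca_starZ hm_ip_star. Qed.
Lemma hm_iprN x y : hm_ip x (- y) = - hm_ip x y.
Proof. by rewrite -hm_ip_star hm_ipNr ca_starN hm_ip_star. Qed.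
Lemma hm_ip_actr a x y : hm_ip x (hm_act a y) = ca_mul (hm_ip x y) (ca_star a).
Proof. by rewrite -hm_ip_star hm_ip_actl ca_starM hm_ip_star. Qed.

Lemma hm_norm_ge0 x : 0 <= hm_norm x. Proof. exact: sqrtr_ge0. Qed.

Lemma hm_norm_sqr x : hm_norm x ^+ 2 = ca_norm (hm_ip x x).
Proof. by rewrite sqr_sqrtr ?ca_norm_ge0. Qed.

Lemma hm_ip0r x : hm_ip x 0 = 0.
Proof. by rewrite -(subrr x) hm_ipDr hm_iprN subrr. Qed.

Let nA : is_norm (@ca_norm R A) := ca_is_norm A.

Lemma hm_ip_sub_act t x y (c := hm_ip y x) (z := y - t%:C *: hm_act c x) :
  (2 * t)%:C *: ca_mul c (ca_star c) + hm_ip z z =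
  (t ^+ 2)%:C *: ca_mul (ca_mul c (hm_ip x x)) (ca_star c) + hm_ip y y.
Proof.
have cs : ca_star c = hm_ip x y by rewrite hm_ip_star.
rewrite /z hm_ipDl !hm_ipDr !hm_ipNr !hm_iprN !hm_ipZl !hm_ipZr.
rewrite !hm_ip_actl !hm_ip_actr -cs conjc_real opprK scalerA.
rewrite -rmorphM -expr2 ca_mulA mulr_natl mulr2n.
rewrite rmorphD scalerDl (addrC _ (hm_ip y y)) -/c.
set u := t%:C *: _; set v := _ *: _.
by rewrite [hm_ip y y - u]addrC [- u + _ + _]addrACA -opprD addNKr.
Qed.

Lemma hm_ip_young t x y : 0 <= t ->
  2 * t * ca_norm (hm_ip y x) ^+ 2 <=
  t ^+ 2 * (ca_norm (hm_ip y x) ^+ 2 * ca_norm (hm_ip x x))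
  + ca_norm (hm_ip y y).
Proof.
move=> t0; set c := hm_ip y x; have t2 : 0 <= 2 * t by lra.
have cc : ca_mul c (ca_star c) = ca_mul (ca_star (ca_star c)) (ca_star c).
  by rewrite ca_starK.
have <- : ca_norm ((2 * t)%:C *: ca_mul c (ca_star c)) = 2 * t * ca_norm c ^+ 2.
  by rewrite (norm_real_scale nA) ger0_norm // cc ca_norm_starM ca_norm_star.
have cc_pos : ca_positive ((2 * t)%:C *: ca_mul c (ca_star c)).
  by apply: ca_positiveZ => //; rewrite cc; exists (ca_star c).
have zz_pos := hm_ip_positive (y - t%:C *: hm_act c x).
apply: le_trans (ca_norm_le_positiveD cc_pos zz_pos) _.
rewrite hm_ip_sub_act; apply: le_trans (norm_triangle nA _ _) _; rewrite lerD2r.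
rewrite (norm_real_scale nA) ger0_norm ?sqr_ge0 // ler_wpM2l ?sqr_ge0 //.
apply: le_trans (ca_normM _ _) _; rewrite ca_norm_star expr2 mulrAC.
by rewrite ler_wpM2r ?ca_norm_ge0 ?ca_normM.
Qed.

Lemma hm_cauchy_schwarz x y : ca_norm (hm_ip y x) <= hm_norm y * hm_norm x.
Proof.
rewrite -(@ler_pXn2r _ 2) ?nnegrE ?mulr_ge0 ?hm_norm_ge0 ?ca_norm_ge0 //.
rewrite exprMn !hm_norm_sqr; set p := ca_norm (hm_ip x x).
have [p_gt0|p_le0] := ltP 0 p; last first.
  rewrite (hm_ip_eq0 (norm_le0_eq0 nA p_le0)) hm_ip0r (norm_zero nA) expr0n.
  by rewrite mulr_ge0 ?ca_norm_ge0.
rewrite -ler_pdivrMr //; have := @hm_ip_young p^-1 x y; rewrite -/p.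
set n := ca_norm (hm_ip y x) ^+ 2.
have -> : p^-1 ^+ 2 * (n * p) = n / p by field; rewrite gt_eqF.
by rewrite invr_ge0 ltW // => /(_ isT); lra.
Qed.

Lemma hm_is_norm : is_norm (@hm_norm R A X).
Proof.
split=> [x x0|x y|l x].
- by apply/hm_ip_eq0/(norm0_eq0 nA); rewrite -hm_norm_sqr x0 expr0n.
- rewrite -(@ler_pXn2r _ 2) ?nnegrE ?addr_ge0 ?hm_norm_ge0 //.
  rewrite hm_norm_sqr hm_ipDl !hm_ipDr sqrrD !hm_norm_sqr.
  have := norm_triangle nA (hm_ip x x + hm_ip x y) (hm_ip y x + hm_ip y y).
  have := norm_triangle nA (hm_ip x x) (hm_ip x y).
  have := norm_triangle nA (hm_ip y x) (hm_ip y y).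
  by have := hm_cauchy_schwarz x y; have := hm_cauchy_schwarz y x; lra.
- rewrite /hm_norm hm_ipZl hm_ipZr !(norm_scale nA) cabs_conj mulrA -expr2.
  by rewrite sqrtrM ?sqr_ge0 // sqrtr_sqr ger0_norm // cabs_ge0.
Qed.

Lemma hm_norm_act a x : hm_norm (hm_act a x) <= ca_norm a * hm_norm x.
Proof.
rewrite -(@ler_pXn2r _ 2) ?nnegrE ?mulr_ge0 ?hm_norm_ge0 ?ca_norm_ge0 //.
rewrite exprMn !hm_norm_sqr hm_ip_actl hm_ip_actr.
apply: le_trans (ca_normM _ _) _.
rewrite expr2 -mulrA ler_wpM2l ?ca_norm_ge0 //.
by rewrite mulrC -(ca_norm_star a) ca_normM.
Qed.

Definition hm_triple x y z : X := hm_act (hm_ip x y) z.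

Lemma hm_triple_scale l m n x y z :
  hm_triple (l *: x) (m *: y) (n *: z) = (l * conjc m * n) *: hm_triple x y z.
Proof.
by rewrite /hm_triple hm_ipZl hm_ipZr scalerA hm_actZl hm_actZr scalerA.
Qed.

Lemma cvg_wrt_triple (u v w : nat -> X) x y z :
  cvg_wrt (@hm_norm R A X) u x -> cvg_wrt (@hm_norm R A X) v y ->
  cvg_wrt (@hm_norm R A X) w z ->
  cvg_wrt (@hm_norm R A X) (fun n => hm_triple (u n) (v n) (w n))
    (hm_triple x y z).
Proof.
move=> ux vy; have nX := hm_is_norm.
apply: (cvg_wrt_biadditive (B := @hm_act R A X) nA nX nX)
  => [a b x'|a x' y'|a x'|].
- by rewrite hm_actDl hm_actNr.
- by rewrite hm_actDr hm_actrN.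
- exact: hm_norm_act.
apply: (cvg_wrt_biadditive (B := @hm_ip R A X) nX nX nA) ux vy
  => [x' y' z'|x' y' z'|x' y'].
- by rewrite hm_ipDl hm_ipNr.
- by rewrite hm_ipDr hm_iprN.
- exact: hm_cauchy_schwarz.
Qed.

End HilbertModule.

(** * Hyers' method *)

Section UnimodularAffineMaps.
Variables (R : realType) (V W : lmodType R[i]) (H : V -> W).
Hypothesis H_affine : forall (mu : R[i]) x y, cabs mu = 1 ->
  H (mu *: x + y) = mu *: H x + H y.
Implicit Types (l m : R[i]) (t : R).

Lemma unimodular_affine_additive x y : H (x + y) = H x + H y.
Proof. by rewrite -{1}[x]scale1r H_affine ?cabs1 ?scale1r. Qed.

Let H0 : H 0 = 0.
Proof. by apply: (addrI (H 0)); rewrite -unimodular_affine_additive !addr0. Qed.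

Definition homogeneous_at l : Prop := forall x, H (l *: x) = l *: H x.

Lemma homogeneous_at_unimodular l : cabs l = 1 -> homogeneous_at l.
Proof. by move=> l1 x; rewrite -[l *: x]addr0 H_affine // H0 addr0. Qed.

Lemma homogeneous_atD l m :
  homogeneous_at l -> homogeneous_at m -> homogeneous_at (l + m).
Proof.
by move=> Hl Hm x; rewrite !scalerDl unimodular_affine_additive Hl Hm.
Qed.

Lemma homogeneous_atM l m :
  homogeneous_at l -> homogeneous_at m -> homogeneous_at (l * m).
Proof. by move=> Hl Hm x; rewrite -!scalerA Hl Hm. Qed.

Lemma homogeneous_at_nat n : homogeneous_at n%:R.
Proof.
elim: n => [|n IH]; first by move=> x; rewrite !scale0r.
rewrite -natr1; apply: homogeneous_atD IH _.
exact/homogeneous_at_unimodular/cabs1.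
Qed.

(* [2 t] is the sum of the two points of the unit circle with real part [t]. *)
Lemma homogeneous_at_small_real t : `|t| <= 1 -> homogeneous_at (2 * t)%:C.
Proof.
move=> t1; set s := Num.sqrt (1 - t ^+ 2).
have s2 : s ^+ 2 = 1 - t ^+ 2.
  by rewrite sqr_sqrtr // subr_ge0 -real_normK ?num_real // exprn_ile1.
have -> : (2 * t)%:C = (t +i* s) + (t -i* s).
  by apply/eqP; rewrite eq_complex /= subrr eqxx andbT; apply/eqP; ring.
by apply: homogeneous_atD; apply: homogeneous_at_unimodular;
  rewrite /= ?sqrrN s2 subrKC sqrtr1.
Qed.

Lemma homogeneous_at_real t : homogeneous_at t%:C.
Proof.
have := archi_boundP (normr_ge0 t); set n := Num.bound _ => tn.
have n0 : 0 < n%:R :> R by apply: le_lt_trans tn.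
have -> : t%:C = n%:R * (2 * (t / (2 * n%:R)))%:C.
  rewrite -(rmorph_nat (real_complex R)) -rmorphM; congr _%:C; field.
  by rewrite gt_eqF.
apply: homogeneous_atM (homogeneous_at_nat n) (homogeneous_at_small_real _).
rewrite normrM normfV (@ger0_norm _ (2 * _)); last by lra.
by rewrite ler_pdivrMr; lra.
Qed.

Lemma unimodular_affine_scalable l x : H (l *: x) = l *: H x.
Proof.
rewrite [l]complexE; move: x; apply: homogeneous_atD (homogeneous_at_real _) _.
apply: homogeneous_atM (homogeneous_at_real _).
exact/homogeneous_at_unimodular/cabs_i.
Qed.

End UnimodularAffineMaps.

Definition doubling_contractive (R : realType) (V : lmodType R[i]) (L : R)
  (psi : V -> R) : Prop := forall x, psi (2 *: x) <= 2 * L * psi x.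

Lemma doubling_contractiveZ (R : realType) (V : lmodType R[i]) (L k : R)
    (psi : V -> R) :
  0 <= k -> doubling_contractive L psi ->
  doubling_contractive L (fun x => k * psi x).
Proof. by move=> k0 psi2 x; rewrite mulrCA ler_wpM2l. Qed.

Definition hyers (R : realType) (V W : lmodType R[i]) (f : V -> W) n x : W :=
  2^-1 ^+ n *: f (2 ^+ n *: x).

Section HyersMethod.
Variables (R : realType) (V W : lmodType R[i]) (N : W -> R) (L : R).
Hypotheses (N_norm : is_norm N) (N_complete : complete_wrt N).
Hypothesis L01 : 0 <= L < 1.
Variable f : V -> W.
Implicit Types (x y : V) (w : W).

Let L_ge0 : 0 <= L. Proof. by case/andP: L01. Qed.

Lemma norm_half_pow n w : N (2^-1 ^+ n *: w) = 2^-1 ^+ n * N w.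
Proof.
have -> : 2^-1 ^+ n = (2^-1 ^+ n)%:C :> R[i].
  by rewrite rmorphXn fmorphV rmorph_nat.
by rewrite (norm_real_scale N_norm) ger0_norm // exprn_ge0 // invr_ge0.
Qed.

Lemma norm_half_pow_le (U : lmodType R[i]) (psi : U -> R) n u w :
  doubling_contractive L psi -> N w <= psi (2 ^+ n *: u) ->
  N (2^-1 ^+ n *: w) <= psi u * L ^+ n.
Proof.
move=> psi2; have psi2n : psi (2 ^+ n *: u) <= (2 * L) ^+ n * psi u.
  elim: n => [|n IH]; first by rewrite !expr0 scale1r mul1r.
  rewrite !exprS -scalerA -[leRHS]mulrA; apply: le_trans (psi2 _) _.
  by rewrite ler_wpM2l // mulr_ge0.
move=> /le_trans/(_ psi2n) w_le; rewrite norm_half_pow.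
have half_n0 : 0 <= 2^-1 ^+ n :> R by rewrite exprn_ge0 // invr_ge0.
apply: le_trans (ler_wpM2l half_n0 w_le) _.
by rewrite mulrA -exprMn mulKf ?pnatr_eq0 // mulrC.
Qed.

Lemma half_pow_cvg0 (U : lmodType R[i]) (psi : U -> R) (w : nat -> W) u :
  doubling_contractive L psi -> (forall n, N (w n) <= psi (2 ^+ n *: u)) ->
  (fun n => N (2^-1 ^+ n *: w n)) @ \oo --> (0 : R).
Proof.
move=> psi2 w_le; apply: squeeze_cvgr (cvg_cst (0 : R)) _; last first.
  by apply: (@cvg_geometric R (psi u) L); rewrite ger0_norm //; case/andP: L01.
by apply: nearW => n; rewrite (norm_ge0 N_norm) /= norm_half_pow_le.
Qed.

Lemma hyers_exists_limit (psi : V -> R) :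
  doubling_contractive L psi ->
  (forall x, N (f (2 *: x) - 2 *: f x) <= psi x) ->
  exists2 H : V -> W, forall x, cvg_wrt N (hyers f ^~ x) (H x) &
    forall x, N (f x - H x) <= (2 - 2 * L)^-1 * psi x.
Proof.
move=> psi2 f2; suff /choice[H HP] x : exists w, cvg_wrt N (hyers f ^~ x) w /\
    N (f x - w) <= (2 - 2 * L)^-1 * psi x.
  by exists H => x; have [] := HP x.
case: (geometric_cvg_wrt N_norm N_complete L01
  (u := hyers f ^~ x) (c := psi x / 2)).
  move=> n; set y := 2 ^+ n *: x.
  have -> : hyers f n.+1 x - hyers f n x =
      2^-1 ^+ 1 *: (2^-1 ^+ n *: (f (2 *: y) - 2 *: f y)).
    rewrite scalerA -exprD /hyers scalerBr !scalerA add1n -exprS.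
    by rewrite [in X in _ = _ - X]exprSr mulfVK ?pnatr_eq0.
  rewrite norm_half_pow expr1 mulrAC mulrC ler_wpM2r ?invr_ge0 //.
  exact: norm_half_pow_le.
move=> w xw /(_ 0%N); rewrite /hyers !expr0 !scale1r mulr1 => wx; exists w.
have <- // : psi x / 2 / (1 - L) = (2 - 2 * L)^-1 * psi x.
by field; case/andP: L01; lra.
Qed.

Lemma hyers_cvg_near (H : V -> W) (psi : V -> R) (k : R) :
  doubling_contractive L psi -> 0 <= k ->
  (forall (l : R[i]) y, H (l *: y) = l *: H y) ->
  (forall y, N (f y - H y) <= k * psi y) ->
  forall x, cvg_wrt N (hyers f ^~ x) (H x).
Proof.
move=> psi2 k_ge0 HZ fH x.
have subE n : hyers f n x - H x =
    2^-1 ^+ n *: (f (2 ^+ n *: x) - H (2 ^+ n *: x)).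
  by rewrite scalerBr HZ scalerA -exprMn mulVf ?pnatr_eq0 // expr1n scale1r.
rewrite /cvg_wrt; under eq_fun do rewrite subE.
by apply: (half_pow_cvg0 (doubling_contractiveZ k_ge0 psi2)) => n; apply: fH.
Qed.

Lemma hyers_limit_affine (H : V -> W) (psi : V * V -> R) (mu : R[i]) :
  doubling_contractive L psi ->
  (forall x y, N (f (mu *: x + y) - mu *: f x - f y) <= psi (x, y)) ->
  (forall x, cvg_wrt N (hyers f ^~ x) (H x)) ->
  forall x y, H (mu *: x + y) = mu *: H x + H y.
Proof.
move=> psi2 f_affine fH x y; apply: (cvg_wrt_unique N_norm (fH _)).
have affine_cvg := cvg_wrtD N_norm (cvg_wrtZ N_norm mu (fH x)) (fH y).
apply: (cvg_wrt_dist0 N_norm affine_cvg).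
have subE n : hyers f n (mu *: x + y) - (mu *: hyers f n x + hyers f n y) =
    2^-1 ^+ n *: (f (mu *: (2 ^+ n *: x) + 2 ^+ n *: y)
      - mu *: f (2 ^+ n *: x) - f (2 ^+ n *: y)).
  by rewrite /hyers !scalerBr scalerDr opprD addrA !scalerA !(mulrC mu).
under eq_fun do rewrite subE.
by apply: (half_pow_cvg0 (u := (x, y)) psi2) => n; apply: f_affine.
Qed.

End HyersMethod.

Section HyersLimitHomomorphism.
Variables (R : realType) (A B : cstar_alg R) (X : hmod A) (Y : hmod B).
Variables (f H : X -> Y) (phi : X * X * X -> R) (L : R).
Hypotheses (L01 : 0 <= L < 1) (phi2 : doubling_contractive L phi).
Hypothesis f_triple : forall x y z,
  hm_norm (f (hm_triple x y z) - hm_triple (f x) (f y) (f z)) <= phi (x, y, z).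
Hypothesis fH : forall x, cvg_wrt (@hm_norm R B Y) (hyers f ^~ x) (H x).

Let nY : is_norm (@hm_norm R B Y) := hm_is_norm Y.

Lemma hyers_triple_sub n x y z :
  hyers f (n * 3) (hm_triple x y z)
    - hm_triple (hyers f n x) (hyers f n y) (hyers f n z) =
  2^-1 ^+ n *: (2^-1 ^+ (n * 2) *:
    (f (hm_triple (2 ^+ n *: x) (2 ^+ n *: y) (2 ^+ n *: z))
     - hm_triple (f (2 ^+ n *: x)) (f (2 ^+ n *: y)) (f (2 ^+ n *: z)))).
Proof.
have conj2 : conjc (2 ^+ n) = 2 ^+ n :> R[i] by rewrite rmorphXn rmorph_nat.
have conj2V : conjc (2^-1 ^+ n) = 2^-1 ^+ n :> R[i].
  by rewrite rmorphXn fmorphV rmorph_nat.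
have cube (t : R[i]) : t ^+ n * t ^+ n * t ^+ n = t ^+ (n * 3).
  by rewrite -!exprD !mulnS muln0 addn0 addnA.
rewrite /hyers !hm_triple_scale conj2 conj2V !cube -scalerBr.
by rewrite [RHS]scalerA -exprD -mulnS.
Qed.

Lemma hyers_limit_triple x y z :
  H (hm_triple x y z) = hm_triple (H x) (H y) (H z).
Proof.
have fH3 : cvg_wrt (@hm_norm R B Y) (fun n => hyers f (n * 3) (hm_triple x y z))
    (H (hm_triple x y z)).
  by apply: (cvg_wrt_subseq nY _ (fH _)) => n; rewrite leq_pmulr.
apply: (cvg_wrt_unique nY fH3).
apply: (cvg_wrt_dist0 nY (cvg_wrt_triple (fH x) (fH y) (fH z))).
under eq_fun do rewrite hyers_triple_sub.
apply: (half_pow_cvg0 nY L01 (u := (x, y, z)) phi2) => n.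
apply: le_trans (f_triple _ _ _).
rewrite (norm_half_pow nY) ler_piMl ?hm_norm_ge0 //.
by rewrite exprn_ile1 // ?invr_ge0 // invf_le1 // ler1n.
Qed.

Lemma hyers_limit_hilbert_hom (psi : X * X -> R) :
  doubling_contractive L psi ->
  (forall (mu : R[i]) x y, cabs mu = 1 ->
     hm_norm (f (mu *: x + y) - mu *: f x - f y) <= psi (x, y)) ->
  hilbert_hom H.
Proof.
move=> psi2 f_affine.
have H_affine mu x y : cabs mu = 1 -> H (mu *: x + y) = mu *: H x + H y.
  move=> mu1; apply: (hyers_limit_affine nY L01 psi2) => // *.
  exact: f_affine.
split; first exact: (unimodular_affine_additive H_affine).
split; first exact: (unimodular_affine_scalable H_affine).
exact: hyers_limit_triple.
Qed.

End HyersLimitHomomorphism.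

Theorem theorem2p2 (R : realType) (A B : cstar_alg R) (X : hmod A) (Y : hmod B)
    (f : X -> Y) (phi : X -> X -> X -> R)
    (phi_ge0 : forall x y z, 0 <= phi x y z)
    (Hadd : forall (mu : R[i]) (x y : X), cabs mu = 1 ->
       hm_norm (f (mu *: x + y) - mu *: f x - f y) <= phi x y 0)
    (Hip : forall x y z : X,
       hm_norm (f (hm_act (hm_ip x y) z) - hm_act (hm_ip (f x) (f y)) (f z))
         <= phi x y z)
    (L : R) (L_ge0 : 0 <= L) (L_lt1 : L < 1)
    (Hphi : forall x y z : X,
       phi x y z <= 2 * L * phi ((2 : R[i])^-1 *: x) ((2 : R[i])^-1 *: y)
                                ((2 : R[i])^-1 *: z)) :
  exists H : X -> Y,
    [/\ hilbert_hom H,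
        (forall x, hm_norm (f x - H x) <= (2 - 2 * L)^-1 * phi x x 0) &
        (forall H' : X -> Y, hilbert_hom H' ->
           (forall x, hm_norm (f x - H' x) <= (2 - 2 * L)^-1 * phi x x 0) ->
           H' = H)].
Proof.
have nY := hm_is_norm Y; have L01 : 0 <= L < 1 by rewrite L_ge0.
have phi_double x y z : phi (2 *: x) (2 *: y) (2 *: z) <= 2 * L * phi x y z.
  by apply: le_trans (Hphi _ _ _) _; rewrite !scalerK // pnatr_eq0.
have phi_diag : doubling_contractive L (fun x => phi x x 0).
  by move=> x; have := phi_double x x 0; rewrite scaler0.
have phi_pair : doubling_contractive L (fun p : X * X => phi p.1 p.2 0).
  by move=> p; have := phi_double p.1 p.2 0; rewrite scaler0.
have phi_triple :
    doubling_contractive L (fun p : X * X * X => phi p.1.1 p.1.2 p.2).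
  by move=> p; apply: phi_double.
have f_double x : hm_norm (f (2 *: x) - 2 *: f x) <= phi x x 0.
  rewrite !scaler_nat !mulr2n opprD addrA.
  by have := Hadd 1 x x (cabs1 R); rewrite !scale1r.
have [H fH f_near_H] :=
  hyers_exists_limit nY (@hm_complete _ _ Y) L01 phi_diag f_double.
exists H; split=> // [|H' [_ [H'Z _]] H'f].
- exact: (hyers_limit_hilbert_hom L01 phi_triple Hip fH phi_pair Hadd).
- have k_ge0 : 0 <= (2 - 2 * L)^-1 by rewrite invr_ge0; lra.
  have fH' := hyers_cvg_near nY L01 phi_diag k_ge0 H'Z H'f.
  by apply/funext => x; apply: (cvg_wrt_unique nY (fH' x) (fH x)).
Qed.
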